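(* For the infinite king grid KNG, $\mathrm{DET{:}OLD\%}(\mathrm{KNG}) \le \frac{13}{30}$; that is, there is a DET:OLD set of KNG of density at most $\frac{13}{30}$.
   Context: The infinite king grid KNG has vertex set $\mathbb{Z}^2$, with distinct vertices $(x,y),(x',y')$ adjacent iff $\max(|x-x'|,|y-y'|)=1$. For a graph $G$ and $v\in V(G)$, $N(v)$ is the open neighborhood of $v$; for $S\subseteq V(G)$ write $N_S(v)=N(v)\cap S$. A set $S\subseteq V(G)$ is a DET:OLD set of $G$ if (1) every vertex $v$ satisfies $|N_S(v)|\ge 2$, and (2) every pair of distinct vertices $u,v$ satisfies $|N_S(u)\setminus N_S(v)|\ge 2$ or $|N_S(v)\setminus N_S(u)|\ge 2$. The density of $S\subseteq\mathbb{Z}^2$ is $\limsup_{r\to\infty}|S\cap B_r|/|B_r|$ where $B_r=\{(x,y):|x|,|y|\le r\}$, and $\mathrm{DET{:}OLD\%}(\mathrm{KNG})$ is the infimum of the densities of DET:OLD sets of KNG. *)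

(* Defs.v *)
From mathcomp Require Import all_boot all_order all_algebra finmap.
From mathcomp Require Import boolp classical_sets functions cardinality.
From mathcomp Require Import reals ereal topology normedtype sequences.
From mathcomp Require Import zify.

Set Implicit Arguments.
Unset Strict Implicit.
Unset Printing Implicit Defensive.

Import Order.TTheory GRing.Theory Num.Theory.

Local Open Scope classical_set_scope.
Local Open Scope card_scope.
Local Open Scope ring_scope.

Record sgraph := SGraph {
  vertex :> Type;
  adj : vertex -> vertex -> Prop;
  adj_sym : forall u v, adj u v -> adj v u;
  adj_irrefl : forall v, ~ adj v v
}.

Definition open_nbhd (G : sgraph) (v : G) : set G := [set u | adj v u].

Definition nbhd_in (G : sgraph) (S : set G) (v : G) : set G :=
  open_nbhd v `&` S.

(* |A| >= 2 is written `I_2 #<= A, which also makes sense when A is infinite. *)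
Definition DET_OLD (G : sgraph) (S : set G) : Prop :=
  (forall v : G, `I_2 #<= nbhd_in S v) /\
  (forall u v : G, u <> v ->
     (`I_2 #<= nbhd_in S u `\` nbhd_in S v) \/
     (`I_2 #<= nbhd_in S v `\` nbhd_in S u)).

Definition king_adj (p q : int * int) : Prop :=
  p <> q /\ Num.max `|p.1 - q.1| `|p.2 - q.2| = 1.

Lemma king_adj_sym p q : king_adj p q -> king_adj q p.
Proof.
move=> [pq pq1]; split; first by move=> qp; exact: pq.
by rewrite (distrC q.1) (distrC q.2).
Qed.

Lemma king_adj_irrefl p : ~ king_adj p p.
Proof. by case. Qed.

Definition KNG : sgraph := SGraph king_adj_sym king_adj_irrefl.

Definition box (r : nat) : set (int * int) :=
  [set p | `|p.1| <= r%:Z /\ `|p.2| <= r%:Z].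

(* [fset_set] is meaningful on finite sets only; every [box r] is finite. *)
Lemma finite_box r : finite_set (box r).
Proof.
pose f (p : nat * nat) : int * int := (p.1%:Z - r%:Z, p.2%:Z - r%:Z).
apply: (@sub_finite_set _ _ (f @` (`I_(r + r).+1 `*` `I_(r + r).+1))).
  move=> [x y] [/= hx hy].
  exists (absz (x + r%:Z), absz (y + r%:Z)) => /=; first by split; lia.
  by rewrite /f /=; congr pair; lia.
by apply: finite_image; apply: finite_setX; exact: finite_II.
Qed.

Definition density (R : realType) (S : set (int * int)) : \bar R :=
  limn_esup (fun r : nat =>
    (#|` fset_set (S `&` box r)|%:R / #|` fset_set (box r)|%:R)%:E).

Definition DET_OLD_pct (R : realType) : \bar R :=
  ereal_inf [set density R S | S in [set S : set KNG | DET_OLD S]].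

(* Main.v *)
(* Membership of (x, y) in S depends only on (x + 13 y) mod 21, so both
   conditions reduce to a finite check: vertices at distance more than 2 have
   disjoint neighbourhoods and are separated as soon as each has two neighbours
   in S, and for the 24 remaining translates it suffices to let the first vertex
   run over the residues mod 21. Nine residues are chosen, and each row of S is
   21-periodic with nine points per period, so S has density
   9/21 = 3/7 < 13/30. The residues were found by simulated annealing. *)
Require Import Defs.
From mathcomp Require Import all_boot all_order all_algebra finmap.
From mathcomp Require Import boolp classical_sets cardinality reals ereal.
From mathcomp Require Import topology sequences zify ring lra.

Import Order.TTheory GRing.Theory Num.Theory.

Local Open Scope classical_set_scope.
Local Open Scope ring_scope.

Lemma card_ge2 (T : Type) (A : set T) (x y : T) :
  A x -> A y -> x <> y -> (`I_2 #<= A)%card.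
Proof.
move=> Ax Ay xy; pose f (i : nat) := if i is 0 then x else y.
have fI : (f @` `I_2 #= `I_2)%card.
  apply: inj_card_eq => -[|[|i]] [|[|j]]; rewrite ?inE //= => _ _ /esym;
  by [move/xy | move/esym/xy].
rewrite -(card_le_eql fI); apply: subset_card_le => _ [[|i] _ <-] //.
Qed.

Definition king_steps : seq (int * int) :=
  [:: (-1, -1); (-1, 0); (-1, 1); (0, -1); (0, 1); (1, -1); (1, 0); (1, 1)].

Lemma mem_king_steps (d : int * int) :
  (d \in king_steps) = [&& d != 0, `|d.1| <= 1 & `|d.2| <= 1].
Proof.
case: d => i j; rewrite !inE !xpair_eqE /=; lia.
Qed.

Lemma king_adjP (u v : int * int) : king_adj u v <-> v - u \in king_steps.
Proof.
rewrite mem_king_steps subr_eq0; case: u v => [x y] [x' y'] /=.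
rewrite /king_adj xpair_eqE /=; split.
  case=> ne m1; apply/and3P; split; [|lia|lia].
  apply/negP => /andP[/eqP ? /eqP ?]; subst; exact: ne.
by case/and3P => ne h1 h2; split; [case=> ? ?; subst; rewrite !eqxx in ne | lia].
Qed.

Definition residue (n : nat) (a : int) (p : int * int) : int :=
  ((p.1 + a * p.2) %% n%:Z)%Z.

Definition cyclic_set (n : nat) (a : int) (D : seq int) : set (int * int) :=
  [set p | residue n a p \in D].

(** [residue n a] is additive modulo [n] and [(c, 0)] has residue [c] modulo [n], so one
    representative per residue stands for all vertices. *)
Lemma residueD n a p q :
  residue n a (p + q) = residue n a ((residue n a p, 0) + q).
Proof.
rewrite /residue /= add0r -[in RHS]addrA modzDml; congr (_ %% _)%Z; ring.
Qed.

(* Here [(c, 0)] represents every vertex of residue [c], and [d] is the offset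
   of the other vertex of the pair. *)
Definition private_count n a (D : seq int) (c : int) (d : int * int) : nat :=
  count (fun o => (o - d \notin king_steps)
                  && (residue n a ((c, 0) + o) \in D)) king_steps.

Definition int_range2 : seq int := [:: -2; -1; 0; 1; 2].

(** The last alternative swaps the roles of the two vertices: seen from [(c, 0) + d], the offset of
    the other one is [- d]. *)
Definition cyclic_check n a (D : seq int) : bool :=
  all (fun c : nat =>
    (1 < count (fun o => residue n a ((c%:Z, 0) + o)%R \in D) king_steps)%N
    && all (fun d =>
              [|| d == 0, (1 < private_count n a D c%:Z d)%N
                | (1 < private_count n a D
                         (residue n a ((c%:Z, 0) + d)%R) (- d)%R)%N])
         [seq (i, j) | i <- int_range2, j <- int_range2])
    (iota 0 n).

(** Translation by [u] is injective, so distinct steps reach distinct points; this turns computable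
    counts into the cardinality bounds of [DET_OLD]. *)
Lemma count_king_steps_card (P : pred (int * int)) (A : set (int * int))
    (u : int * int) :
  (forall o, o \in king_steps -> P o -> A (u + o)) ->
  (1 < count P king_steps)%N -> (`I_2 #<= A)%card.
Proof.
move=> PA; rewrite -size_filter.
have : uniq (seq.filter P king_steps) by exact: filter_uniq.
have : {subset seq.filter P king_steps <= [pred o | P o & o \in king_steps]}.
  by move=> o; rewrite mem_filter.
case: (seq.filter P king_steps) => [|x [|y s]] // sP /andP[]; rewrite inE negb_or.
case/andP => /eqP xy _ _ _.
have /andP[Px sx] := sP x (mem_head _ _).
have /andP[Py sy] : y \in [pred o | P o & o \in king_steps].
  by apply: sP; rewrite !inE eqxx orbT.
apply: (@card_ge2 _ _ (u + x) (u + y)); [exact: PA | exact: PA |].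
by move/addrI.
Qed.

(** The point [u + o] is adjacent to [u + d] exactly when [o - d] is a king step. Since 0 is not a
    step, [o = d] counts as private, as open neighbourhoods require. *)
Lemma private_count_card n a D (u d : int * int) :
  (1 < private_count n a D (residue n a u) d)%N ->
  (`I_2 #<= @nbhd_in KNG (cyclic_set n a D) u
          `\` @nbhd_in KNG (cyclic_set n a D) (u + d)%R)%card.
Proof.
apply: (@count_king_steps_card _ _ u) => o so /andP[sod rD]; split.
  split; first by apply/king_adjP; rewrite addrC addKr.
  by rewrite /cyclic_set /= residueD.
case=> /king_adjP + _; rewrite opprD addrACA subrr add0r.
exact/negP.
Qed.

Lemma cyclic_set_DET_OLD n a D :
  (0 < n)%N -> cyclic_check n a D -> @DET_OLD KNG (cyclic_set n a D).
Proof.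
move=> n0 /allP ok.
have okr u : exists2 c : nat, c%:Z = residue n a u & c \in iota 0 n.
  exists `|residue n a u|%N; rewrite /residue ?mem_iota; lia.
have dom (u : KNG) : (1 < count
    (fun o => residue n a ((residue n a u, 0) + o)%R \in D) king_steps)%N.
  by have [c <- /ok/andP[]] := okr u.
split=> [u|u v uv].
  move: (dom u); apply: (@count_king_steps_card _ _ u) => o so rD; split.
    by apply/king_adjP; rewrite addrC addKr.
  by rewrite /cyclic_set /= residueD.
move: u v uv => [x y] [x' y'].
pose u := (x, y) : int * int; pose v := (x', y') : int * int.
pose d : int * int := v - u; rewrite -/u -/v => uv.
have vE : v = u + d by rewrite /d addrC subrK.
have uE : u = v - d by rewrite vE addrK.
have d0 : d != 0 by rewrite subr_eq0; apply/eqP => vu; exact: uv.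
case: (boolP ((`|d.1| <= 2) && (`|d.2| <= 2))) => [dle|dgt].
  have [c cE /ok/andP[_ /allP/(_ d)]] := okr u.
  have -> : d \in [seq (i, j) | i <- int_range2, j <- int_range2].
    have /andP[d1 d2] := dle; apply/allpairsP; exists d.
    split; [move: d1 | move: d2 | by case: (d)].
      by move: d.1 => i i2; rewrite !inE; lia.
    by move: d.2 => j j2; rewrite !inE; lia.
  move=> /(_ isT); rewrite (negPf d0) orFb cE -residueD -vE => /orP[].
    by move/private_count_card; rewrite -vE; left.
  by move/private_count_card; rewrite -uE; right.
left; rewrite vE; apply: private_count_card.
apply: (leq_trans (dom u)); rewrite /private_count.
apply/eq_leq/eq_in_count => o so.
(* A coordinate of [d] beyond 2 in absolute value leaves one beyond 1 in [o - d], so every neighbour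
   of [u] in the set is private. *)
suff -> : o - d \notin king_steps by [].
move: so dgt; rewrite !mem_king_steps; case: (d) (o) => i j [k l] /=.
by case/and3P => _ h1 h2 h3; apply/negP => /and3P[_ h4 h5]; lia.
Qed.

(** The box is the denominator of the density, so an upper bound on the density calls for a lower
    bound here. *)
Lemma card_box_ge (r : nat) :
  (r.*2.+1 * r.*2.+1 <= #|` fset_set (box r)|)%N.
Proof.
pose g (i j : nat) : int * int := (i%:Z - r%:Z, j%:Z - r%:Z).
pose s := [seq g i j | i <- iota 0 r.*2.+1, j <- iota 0 r.*2.+1].
have <- : size s = (r.*2.+1 * r.*2.+1)%N by rewrite size_allpairs size_iota.
apply: uniq_leq_size.
  apply: allpairs_uniq; rewrite ?iota_uniq // => -[i j] [k l] _ _ /= [ik jl].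
  by congr pair; lia.
move=> p /allpairsP[ij []]; rewrite !mem_iota.
case: ij => i j /= ir jr ->.
by rewrite (in_fset_set (finite_box r)) inE /box /g /=; split; lia.
Qed.

(* A point of the set in [box r] is determined by its row, the quotient of its
   shifted abscissa by [n], and its residue. *)
Lemma card_cyclic_set_box n a D (r : nat) : (0 < n)%N ->
  (#|` fset_set (cyclic_set n a D `&` box r)|
     <= r.*2.+1 * ((r.*2 %/ n).+1 * size D))%N.
Proof.
move=> n0.
(* [g] decodes such a triple: on row [y], a point of residue [c] has shifted abscissa [x + r]
   congruent to [c - a * y + r] modulo [n]. *)
pose g (j : nat) (tc : nat * int) : int * int :=
  let y := j%:Z - r%:Z in
  (tc.1%:Z * n%:Z + ((tc.2 - a * y + r%:Z) %% n%:Z)%Z - r%:Z, y).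
pose s := [seq g j tc | j <- iota 0 r.*2.+1,
             tc <- [seq (t, c) | t <- iota 0 (r.*2 %/ n).+1, c <- D]].
have <- : size s = (r.*2.+1 * ((r.*2 %/ n).+1 * size D))%N.
  by rewrite !size_allpairs !size_iota.
apply: uniq_leq_size; first exact: fset_uniq.
have fin : finite_set (cyclic_set n a D `&` box r).
  by apply: finite_setIr; exact: finite_box.
suff sub (x y : int) : (cyclic_set n a D `&` box r) (x, y) -> (x, y) \in s.
  by case=> x y; rewrite (in_fset_set fin) inE; exact: sub.
case=> cD [/= xr yr].
have [X XE] : exists X : nat, X%:Z = x + r%:Z by exists (absz (x + r%:Z)); lia.
apply/allpairsP; exists (absz (y + r%:Z), ((X %/ n)%N, residue n a (x, y))).
split; first by rewrite mem_iota /=; lia.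
  apply: allpairs_f => //; rewrite mem_iota /= add0n ltnS.
  by apply: leq_div2r; lia.
have yE : (absz (y + r%:Z))%:Z - r%:Z = y by lia.
rewrite /g /= yE; congr pair; rewrite /residue /=.
have -> : ((x + a * y) %% n%:Z)%Z - a * y + r%:Z =
          ((x + a * y) %% n%:Z)%Z + (r%:Z - a * y) by ring.
rewrite modzDml.
have -> : x + a * y + (r%:Z - a * y) = X%:Z by lia.
by rewrite -divz_nat -divz_eq; lia.
Qed.

(** The limit superior is an infimum of suprema over neighbourhoods of infinity, and the tail from
    [N] is one of them. *)
Lemma limn_esup_le (R : realType) (u : (\bar R)^nat) (l : \bar R) (N : nat) :
  (forall r, (N <= r)%N -> (u r <= l)%E) -> (limn_esup u <= l)%E.
Proof.
move=> ul; apply: (@le_trans _ _ (ereal_sup (u @` [set r | (N <= r)%N]))).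
  apply: ereal_inf_lbound; exists [set r | (N <= r)%N] => //.
  exact: nbhs_infty_ge.
by apply: ge_ereal_sup => _ [r /= Nr <-]; exact: ul.
Qed.

Lemma density_cyclic_set (R : realType) n a D : (0 < n)%N ->
  (density R (cyclic_set n a D) <= ((size D)%:R / n%:R)%:E)%E.
Proof.
move=> n0; apply/lee_addgt0Pr => e e0; rewrite -EFinD.
set k := size D.
(* An incomplete period adds at most [k] points to a row; beyond [k / e] this excess is at most
   [e * r]. *)
apply: (@limn_esup_le _ _ _ (Num.truncn (k%:R / e)).+1) => r Nr.
rewrite lee_fin.
have er : k%:R <= e * r%:R.
  rewrite mulrC -ler_pdivrMr //; apply: (le_trans (ltW (truncnS_gt _))).
  by rewrite ler_nat.
have := card_box_ge r; have := @card_cyclic_set_box n a D r n0; rewrite -/k.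
move: (#|` _|) (#|` _|) => B A Ale Bge.
have B0 : 0 < B%:R :> R by rewrite ltr0n; exact: (leq_trans _ Bge).
have n0' : 0 < n%:R :> R by rewrite ltr0n.
have c0 : 0 <= k%:R / n%:R + e by rewrite addr_ge0 ?(ltW e0) // divr_ge0.
rewrite ler_pdivrMr //.
apply: (@le_trans _ _ ((k%:R / n%:R + e) * (r.*2.+1 * r.*2.+1)%:R)); last first.
  by rewrite ler_wpM2l // ler_nat.
apply: (@le_trans _ _ (r.*2.+1 * ((r.*2 %/ n).+1 * k))%:R).
  by rewrite ler_nat.
rewrite !natrM [leRHS]mulrCA ler_wpM2l //.
have q1 : (r.*2 %/ n).+1%:R <= r.*2%:R / n%:R + 1 :> R.
  by rewrite -natr1 lerD2r ler_pdivlMr // -natrM ler_nat leq_trunc_div.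
apply: (le_trans (ler_wpM2r (ler0n R k) q1)).
have kn0 : 0 <= k%:R / n%:R :> R by rewrite divr_ge0.
have r2 : r.*2.+1%:R = r%:R + r%:R + 1 :> R by rewrite -natr1 -addnn natrD.
rewrite r2 -addnn natrD.
have -> : ((r%:R + r%:R) / n%:R + 1) * k%:R =
          k%:R / n%:R * (r%:R + r%:R) + k%:R :> R by ring.
have : 0 <= e * r%:R by rewrite mulr_ge0 // ltW.
(* With the number of rows cancelled, what remains is [z * 2r + k <= (z + e) * (2r + 1)]. *)
move: kn0 er e0; move: (k%:R / n%:R) => z; nra.
Qed.

Lemma DET_OLD_density_3_7 (R : realType) :
  exists S : set KNG, DET_OLD S /\ (density R S <= (3 / 7)%:E)%E.
Proof.
exists (cyclic_set 21 13 [:: 1; 5; 6; 9; 12; 13; 15; 16; 19]); split.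
  by apply: cyclic_set_DET_OLD => //; vm_compute.
apply: (le_trans (density_cyclic_set R 21 13 _ isT)).
by rewrite lee_fin /=; lra.
Qed.

Theorem theorem7 (R : realType) :
  (DET_OLD_pct R <= (13 / 30)%:E)%E /\
  exists S : set KNG, DET_OLD S /\ (density R S <= (13 / 30)%:E)%E.
Proof.
have [S [S_DET S_dens]] := DET_OLD_density_3_7 R.
have S_dens' : (density R S <= (13 / 30)%:E)%E.
  (* Over the common denominator 210 this compares 90 with 91. *)
  by apply: le_trans S_dens _; rewrite lee_fin; lra.
split; last by exists S.
by apply: le_trans S_dens'; apply: ereal_inf_lbound; exists S.
Qed.
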